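(* Let $M\in\mathcal A$ and $P\in\mathscr P$, with dimension vectors $\mathbf m$ and $\mathbf p$. If $\widetilde E'\mathbf p=\mathbf t_P$, then $\Psi(\mathbb X_{M\oplus P[1]})=X_{M\oplus P[1]}$, where $$X_{M\oplus P[1]}=\sum_{\mathbf e}v^{\langle\mathbf p-\mathbf e,\mathbf m-\mathbf e\rangle}|\mathrm{Gr}_{\mathbf e}M|\,X^{-\widetilde B\mathbf e-\widetilde E\mathbf m+\mathbf t_P}\in\mathcal T_\Lambda$$ is the quantum cluster character associated to $M\oplus P[1]$, $\mathrm{Gr}_{\mathbf e}M$ is the set of submodules of $M$ of dimension vector $\mathbf e$, and $\mathbf t_P=\mathbf{dim}(P/\operatorname{rad}P)$.
   Context: Setting. Let $k=\mathbb{F}_q$, $v=\sqrt q$; tensor products are over $\mathbb{Z}[v,v^{-1}]$. Let $Q$ be a finite acyclic valued quiver with vertices $1,\dots,n$ and valuations $d_1,\dots,d_n$; let $m=2n$ and let $\widetilde Q$ be a valued quiver obtained from $Q$ by attaching additional vertices $n+1,\dots,m$ (so $Q$ is the full subquiver on $1,\dots,n$). Let $\mathfrak S$, $\widetilde{\mathfrak S}$ be the $k$-species associated to $Q$, $\widetilde Q$, identified with their tensor algebras; $\mathfrak S$ is a finite dimensional hereditary $k$-algebra. Let $S_i$ be the $i$-th simple $\widetilde{\mathfrak S}$-module, $\mathcal D_i=\operatorname{End}_{\widetilde{\mathfrak S}}(S_i)$, of $k$-dimension $d_i$. Let $\widetilde R,\widetilde R'$ be the $m\times n$ matrices with entries $r_{ij}=\dim_{\mathcal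 D_i}\operatorname{Ext}^1_{\widetilde{\mathfrak S}}(S_j,S_i)$ and $r'_{ij}=\dim_{\mathcal D_i^{op}}\operatorname{Ext}^1_{\widetilde{\mathfrak S}}(S_i,S_j)$; let $\widetilde I$ be the left $m\times n$ submatrix of $I_m$; put $\widetilde B=\widetilde R'-\widetilde R$, $\widetilde E=\widetilde I-\widetilde R'$, $\widetilde E'=\widetilde I-\widetilde R$. Assume $\Lambda$ is a skew-symmetric integral $m\times m$ matrix with $\Lambda(-\widetilde B)=\binom{D_n}{0}$, $D_n=\mathrm{diag}(d_1,\dots,d_n)$; also write $\Lambda(\cdot,\cdot)$ for the associated bilinear form on $\mathbb{Z}^m$. For $\alpha\in\mathbb{Z}^n$ put $\widetilde\alpha=\binom{\mathbf 0}{\alpha}$, $\bar\alpha=\binom{\alpha}{\mathbf 0}\in\mathbb{Z}^{2n}$. The vector $\mathbf t_P\in\mathbb{Z}^n$ is regarded as an element of $\mathbb{Z}^m$ by adding zero entries. Hall algebra of morphisms. $\mathcal{A}$ is the category of finite dimensional left $\mathfrak S$-modules, $\mathscr P$ its projectives; $K(\mathcal A)=\mathbb{Z}^n$ via dimension vectors. $\langle M,N\rangle=\dim_k\operatorname{Hom}(M,N)-\dim_k\operatorname{Ext}^1(M,N)$ induces the Euler form on $\mathbb{Z}^n$; $(\alpha,\beta)=\langle\alpha,\beta\rangle+\langle\beta,\alpha\rangle$. $F_{MN}^L=|\{N'\subset L:N'\cong N,L/N'\cong M\}|$. $C_2(\mathscr P)$ is the category of morphisms $M_\bullet=(M_{-1}\to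 M_0)$ in $\mathscr P$ (morphisms: commutative squares), with $\langle M_\bullet,N_\bullet\rangle=\dim_k\operatorname{Hom}(M_\bullet,N_\bullet)-\dim_k\operatorname{Ext}^1(M_\bullet,N_\bullet)$. $\mathcal H_{\rm tw}(C_2(\mathscr P))$ is the free $\mathbb{Z}[v,v^{-1}]$-module on isomorphism classes $[M_\bullet]$ with $[M_\bullet]\ast[N_\bullet]=q^{\langle M_\bullet,N_\bullet\rangle}\sum_{[L_\bullet]}\frac{|\operatorname{Ext}^1(M_\bullet,N_\bullet)_{L_\bullet}|}{|\operatorname{Hom}(M_\bullet,N_\bullet)|}[L_\bullet]$ (subscript: extensions with middle term isomorphic to $L_\bullet$). Put $K_P=(P\xrightarrow{1}P)$, $Z_P=(P\to0)$, and $C_M=(\Omega_M\xrightarrow{\delta_M}P_M)$ for a minimal projective resolution $0\to\Omega_M\xrightarrow{\delta_M}P_M\to M\to0$. $\mathcal{MH}(\mathcal A)$ is the localization of $\mathcal H_{\rm tw}(C_2(\mathscr P))$ at the (central) elements $[K_P]$. Put $K_\alpha=[K_P]\ast[K_Q]^{-1}$ if $\alpha=\hat P-\hat Q$ ($P,Q\in\mathscr P$), $\mathbb X_M=K_{-\hat P_M}\ast[C_M]$, $\mathbb X_{P[1]}=[Z_P]$, $\mathbb X_{M\oplus P[1]}=\mathbb X_M\ast\mathbb X_{P[1]}$. The elements $K_\alpha\ast\mathbb X_{M\oplus P[1]}$ form a basis of $\mathcal{MH}(\mathcal A)$. The map $\Psi=\mu\circ(\int\otimes\int)\circ\Delta:\mathcal{MH}(\mathcal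 A)\to\mathcal T_\Lambda$. Here: (i) $\Delta(K_\alpha\ast\mathbb X_{L\oplus P[1]})=\sum_{[M],[N]}q^{\langle\hat M,\hat N-\hat P\rangle}F_{MN}^L(\mathbb X_M\otimes K_\alpha\ast\mathbb X_{N\oplus P[1]})$. (ii) $\mathcal T$ is the free $\mathbb{Z}[v,v^{-1}]$-module with basis $X^\alpha$, $\alpha\in\mathbb{Z}^{2n}$, and $\int:\mathcal{MH}(\mathcal A)\to\mathcal T$ is the linear map with $\int K_\alpha\ast\mathbb X_{M\oplus P[1]}=X^{\widetilde\alpha+\bar{\mathbf m}-\bar{\mathbf p}}$. (iii) $\mathcal T_\Lambda$ is the $\mathbb{Z}[v,v^{-1}]$-algebra with basis $X^\alpha$, $\alpha\in\mathbb{Z}^m$, and $X^\alpha\star X^\beta=v^{\Lambda(\alpha,\beta)}X^{\alpha+\beta}$; $\mu:\mathcal T\otimes\mathcal T\to\mathcal T_\Lambda$ is the linear map $\mu(X^{\binom{\alpha_1}{\alpha_2}}\otimes X^{\binom{\beta_1}{\beta_2}})=v^{-(\alpha_1,\beta_1)-\langle\alpha_1,\beta_1\rangle}X^{-\widetilde E\alpha_1-\widetilde E'\beta_1+\widetilde\alpha_2+\widetilde\beta_2}$. *)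

(* Defs.v *)
From HB Require Import structures.
From mathcomp Require Import all_boot all_order all_algebra.
From mathcomp Require Import generic_quotient ring_quotient falgebra algC.
From mathcomp Require Import finmap monalg.
From mathcomp Require Import boolp classical_sets functions fsbigop.
From mathcomp Require Import finset.

Set Implicit Arguments.
Unset Strict Implicit.
Unset Printing Implicit Defensive.

Import Order.TTheory GRing.Theory Num.Theory.
Local Open Scope quotient_scope.
Local Open Scope set_scope.
Local Open Scope ring_scope.

Section LaurentRing.
Variable k : finFieldType.

(* The coefficient ring Z[v, 1/v], v = sqrt q with q = #|k|, is realised as a
   subring [laurent k] of algC; [vq k] is the element v. *)
Definition sqrtq : algC := sqrtC #|k|%:R.

Lemma sqrtq_neq0 : sqrtq != 0.
Proof. by rewrite sqrtC_eq0 pnatr_eq0 -lt0n; apply/card_gt0P; exists 0. Qed.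

Definition laurent_pred : {pred algC} := fun x =>
  `[< exists s : seq (int * int), x = \sum_(c <- s) c.1%:~R * sqrtq ^ c.2 >].

Lemma laurent_subring : subring_closed laurent_pred.
Proof.
split=> [|x y /asboolP[s ->] /asboolP[t ->]|x y /asboolP[s ->] /asboolP[t ->]];
  apply/asboolP.
- by exists [:: (1, 0)]; rewrite big_seq1 mul1r.
- exists (s ++ [seq (- c.1, c.2) | c <- t]); rewrite big_cat big_map /= -sumrN.
  by congr (_ + _); apply: eq_bigr => c _; rewrite intrN mulNr.
exists [seq (c.1 * d.1, c.2 + d.2) | c <- s, d <- t].
rewrite big_allpairs_dep /= mulr_suml; apply: eq_bigr => c _.
rewrite mulr_sumr; apply: eq_bigr => d _.
by rewrite expfzDr ?sqrtq_neq0// intrM mulrACA.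
Qed.

HB.instance Definition _ := GRing.isSubringClosed.Build algC laurent_pred
  laurent_subring.

Record laurent := Laurent {laurent_val : algC; _ : laurent_val \in laurent_pred}.
HB.instance Definition _ := [isSub for laurent_val].
HB.instance Definition _ := [Choice of laurent by <:].
HB.instance Definition _ := [SubChoice_isSubComNzRing of laurent by <:].

Definition laurent_unit : pred laurent := fun x =>
  (val x != 0) && ((val x)^-1 \in laurent_pred).
Definition laurent_inv (x : laurent) : laurent := insubd x (val x)^-1.

Fact laurent_mulVx : {in laurent_unit, left_inverse 1 laurent_inv *%R}.
Proof.
move=> x /andP[x0 xV]; apply: val_inj.
by rewrite rmorphM /= /laurent_inv insubdK// mulVf// rmorph1.
Qed.

Fact laurent_unitP (x y : laurent) : y * x = 1 -> laurent_unit x.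
Proof.
move=> /(congr1 val); rewrite rmorphM rmorph1 /= => yx1.
have x0 : val x != 0.
  by apply: contra_eq_neq yx1 => ->; rewrite mulr0 eq_sym oner_neq0.
rewrite /laurent_unit -topredE /= x0; have -> : (val x)^-1 = val y; last exact: valP.
by apply: (mulIf x0); rewrite mulVf.
Qed.

Fact laurent_inv_out : {in [predC laurent_unit], laurent_inv =1 id}.
Proof.
move=> x; rewrite inE /= negb_and negbK -topredE /=.
case/orP => [/eqP x0|xV]; apply: val_inj.
  by rewrite /laurent_inv /insubd; case: insubP => //= u _ ->; rewrite [laurent_val x]x0 invr0.
by rewrite /laurent_inv /insubd insubN.
Qed.

HB.instance Definition _ := GRing.ComNzRing_hasMulInverse.Build laurent
  laurent_mulVx laurent_unitP laurent_inv_out.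

Fact sqrtq_laurent : sqrtq \in laurent_pred.
Proof. by apply/asboolP; exists [:: (1, 1)]; rewrite big_seq1 mul1r. Qed.

Definition vq : laurent := Laurent sqrtq_laurent.

Lemma vq_unit : vq \is a GRing.unit.
Proof.
apply/andP; split; first exact: sqrtq_neq0.
by apply/asboolP; exists [:: (1, -1)]; rewrite big_seq1 mul1r exprN1.
Qed.

Lemma vqq : vq ^+ 2 = #|k|%:R.
Proof. by apply: val_inj; rewrite rmorphXn rmorph_nat /= sqrtCK. Qed.

End LaurentRing.

Section LinearExtension.
Variables (R : comNzRingType) (K L : choiceType) (V : lmodType R).

(* Linear (resp. bilinear) extension of a map given on the basis of a free module. *)
Definition lin_ext (f : K -> V) (x : {malg R[K]}) : V :=
  \sum_(a <- msupp x) x@_a *: f a.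

Lemma lin_ext_wid f x (d : {fset K}) : (msupp x `<=` d)%fset ->
  lin_ext f x = \sum_(a <- d) x@_a *: f a.
Proof.
move=> le; rewrite [LHS](big_fset_incl _ le) => //= a ad /mcoeff_outdom ->.
by rewrite scale0r.
Qed.

Lemma lin_ext_linear f : linear (lin_ext f).
Proof.
move=> c x y; pose d := (msupp x `|` msupp y `|` msupp (c *: x + y))%fset.
rewrite !(@lin_ext_wid f _ d) ?fsubsetUr//; first last.
- by rewrite /d -fsetUA fsubsetUl.
- by rewrite /d fsetUAC fsubsetUr.
rewrite scaler_sumr -big_split; apply: eq_bigr => a _ /=.
by rewrite mcoeffD mcoeffZ scalerDl scalerA.
Qed.
HB.instance Definition _ f :=
  GRing.isLinear.Build R {malg R[K]} V _ (lin_ext f) (lin_ext_linear f).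

Lemma lin_extU f a : lin_ext f << a >> = f a.
Proof.
by rewrite (@lin_ext_wid f _ [fset a]%fset) ?msuppU_le// big_seq_fset1 mcoeffUU scale1r.
Qed.

Definition bilin_ext (f : K -> L -> V) (x : {malg R[K]}) (y : {malg R[L]}) : V :=
  \sum_(a <- msupp x) \sum_(b <- msupp y) (x@_a * y@_b) *: f a b.

End LinearExtension.

Section BilinearExtension.
Variables (R : comNzRingType) (K L : choiceType) (V : lmodType R).
Implicit Types (f : K -> L -> V).

Lemma bilin_extE f x y :
  bilin_ext f x y = lin_ext (fun a => lin_ext (f a) y) x :> V.
Proof.
apply: eq_bigr => a _; rewrite scaler_sumr; apply: eq_bigr => b _.
by rewrite scalerA.
Qed.

Lemma bilin_extPl f c x x' y :
  bilin_ext f (c *: x + x') y = c *: bilin_ext f x y + bilin_ext f x' y.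
Proof. by rewrite !bilin_extE linearP. Qed.

Lemma bilin_extPr f c x y y' :
  bilin_ext f x (c *: y + y') = c *: bilin_ext f x y + bilin_ext f x y'.
Proof.
rewrite !bilin_extE /lin_ext scaler_sumr -big_split; apply: eq_bigr => a _ /=.
by rewrite -!/(lin_ext _ _) linearP scalerDr !scalerA mulrC.
Qed.

Lemma bilin_extU f a b : bilin_ext f << a >> << b >> = f a b.
Proof. by rewrite bilin_extE !lin_extU. Qed.

Lemma eq_linear_malg (f g : {malg R[K]} -> V) : linear f -> linear g ->
  (forall a, f << a >> = g << a >>) -> f =1 g.
Proof.
move=> fl gl fg x.
have [f0 g0] : f 0 = 0 /\ g 0 = 0.
  split; first by have := fl (-1) 0 0; rewrite scaleN1r oppr0 addr0 scaleN1r addNr.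
  by have := gl (-1) 0 0; rewrite scaleN1r oppr0 addr0 scaleN1r addNr.
rewrite [x]monalgE; elim/big_ind: _ => [|y z fy fz|a _]; first by rewrite f0 g0.
  by rewrite -[y]scale1r fl gl -fz; congr (_ *: _ + _).
have -> : << x@_a *g a >> = x@_a *: << a >> :> {malg R[K]}.
  by apply/malgP => b; rewrite mcoeffZ !mcoeffU; case: eqP; rewrite ?mulr1 ?mulr0.
by rewrite -[_ *: _]addr0 fl gl fg f0 g0.
Qed.

End BilinearExtension.

Section Tensor.
Variables (R : comNzRingType) (M N : lmodType R).

(* The tensor product is the free module on M * N modulo the submodule spanned by
   the bilinearity relations. *)
Inductive tensor_null : {malg R[(M * N)%type]} -> Prop :=
| TensorNull0 : tensor_null 0
| TensorNullP a x y :
    tensor_null x -> tensor_null y -> tensor_null (a *: x + y)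
| TensorNullL a m m' n :
    tensor_null (<< (a *: m + m', n) >> - a *: << (m, n) >> - << (m', n) >>)
| TensorNullR a m n n' :
    tensor_null (<< (m, a *: n + n') >> - a *: << (m, n) >> - << (m, n') >>).

Definition tensor_null_pred : {pred {malg R[(M * N)%type]}} :=
  fun x => `[< tensor_null x >].

Lemma tensor_nullZ a x : tensor_null x -> tensor_null (a *: x).
Proof. by move=> x0; rewrite -[_ *: _]addr0; exact: TensorNullP x0 TensorNull0. Qed.

Lemma tensor_null_zmod : zmod_closed tensor_null_pred.
Proof.
split=> [|x y /asboolP x0 /asboolP y0]; apply/asboolP; first exact: TensorNull0.
by rewrite addrC -scaleN1r; exact: TensorNullP.
Qed.
HB.instance Definition _ :=
  GRing.isZmodClosed.Build _ tensor_null_pred tensor_null_zmod.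

Definition tensor : Type := Quotient.quot tensor_null_pred.
HB.instance Definition _ := GRing.Zmodule.on tensor.

Definition tensor_pi (x : {malg R[(M * N)%type]}) : tensor :=
  \pi_(Quotient.quot tensor_null_pred) x.
Definition tensor_repr (t : tensor) : {malg R[(M * N)%type]} :=
  repr (t : Quotient.quot tensor_null_pred).

Lemma tensor_reprK : cancel tensor_repr tensor_pi.
Proof. by move=> t; exact: reprK. Qed.

Lemma tensor_piE x y : tensor_pi x = tensor_pi y <-> tensor_null (x - y).
Proof.
split=> [/eqP|xy].
  by rewrite /tensor_pi -[_ == _]Quotient.idealrBE => /asboolP.
by apply/eqP; rewrite /tensor_pi -[_ == _]Quotient.idealrBE; apply/asboolP.
Qed.

Lemma tensor_piD x y : tensor_pi (x + y) = tensor_pi x + tensor_pi y.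
Proof. exact: raddfD. Qed.

Definition tensor_scale (a : R) (t : tensor) : tensor :=
  tensor_pi (a *: tensor_repr t).

Lemma tensor_scale_pi a x : tensor_scale a (tensor_pi x) = tensor_pi (a *: x).
Proof.
apply/tensor_piE; rewrite -scalerBr; apply: tensor_nullZ.
by apply/tensor_piE; exact: tensor_reprK.
Qed.

Fact tensor_scalerA a b t :
  tensor_scale a (tensor_scale b t) = tensor_scale (a * b) t.
Proof. by rewrite -[t]tensor_reprK !tensor_scale_pi scalerA. Qed.
Fact tensor_scale1r : left_id 1 tensor_scale.
Proof. by move=> t; rewrite -[t]tensor_reprK tensor_scale_pi scale1r. Qed.
Fact tensor_scalerDr : right_distributive tensor_scale +%R.
Proof.
move=> a s t; rewrite -[s]tensor_reprK -[t]tensor_reprK.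
by rewrite -tensor_piD !tensor_scale_pi scalerDr tensor_piD.
Qed.
Fact tensor_scalerDl t : {morph tensor_scale^~ t : a b / a + b}.
Proof.
by move=> a b; rewrite -[t]tensor_reprK !tensor_scale_pi scalerDl tensor_piD.
Qed.
HB.instance Definition _ := GRing.Zmodule_isLmodule.Build R tensor
  tensor_scalerA tensor_scale1r tensor_scalerDr tensor_scalerDl.

Definition tens (m : M) (n : N) : tensor := tensor_pi << (m, n) >>.

Lemma tensPl a m m' n : tens (a *: m + m') n = a *: tens m n + tens m' n.
Proof.
rewrite [a *: tens _ _]tensor_scale_pi -tensor_piD; apply/tensor_piE.
by rewrite opprD addrA; exact: TensorNullL.
Qed.

Lemma tensPr a m n n' : tens m (a *: n + n') = a *: tens m n + tens m n'.
Proof.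
rewrite [a *: tens _ _]tensor_scale_pi -tensor_piD; apply/tensor_piE.
by rewrite opprD addrA; exact: TensorNullR.
Qed.

Variable V : lmodType R.

Definition tensor_lift (f : M -> N -> V) (t : tensor) : V :=
  lin_ext (fun p => f p.1 p.2) (tensor_repr t).

Lemma tensor_lift_pi f x :
  (forall a m m' n, f (a *: m + m') n = a *: f m n + f m' n) ->
  (forall a m n n', f m (a *: n + n') = a *: f m n + f m n') ->
  tensor_lift f (tensor_pi x) = lin_ext (fun p => f p.1 p.2) x.
Proof.
move=> fl fr; apply/eqP; rewrite -subr_eq0 -linearB; apply/eqP.
have : tensor_null (tensor_repr (tensor_pi x) - x).
  by apply/tensor_piE; exact: tensor_reprK.
elim=> [|a y z _ y0 _ z0|a m m' n|a m n n']; first by rewrite linear0.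
- by rewrite linearP /= y0 z0 scaler0 addr0.
- by rewrite !linearB linearZ /= !lin_extU /= fl -addrA -opprD subrr.
- by rewrite !linearB linearZ /= !lin_extU /= fr -addrA -opprD subrr.
Qed.

Lemma tensor_lift_tens f m n :
  (forall a m m' n, f (a *: m + m') n = a *: f m n + f m' n) ->
  (forall a m n n', f m (a *: n + n') = a *: f m n + f m n') ->
  tensor_lift f (tens m n) = f m n.
Proof. by move=> fl fr; rewrite tensor_lift_pi// lin_extU. Qed.

Lemma tensor_lift_linear f :
  (forall a m m' n, f (a *: m + m') n = a *: f m n + f m' n) ->
  (forall a m n n', f m (a *: n + n') = a *: f m n + f m n') ->
  linear (tensor_lift f).
Proof.
move=> fl fr a s t; rewrite -[s]tensor_reprK -[t]tensor_reprK.
rewrite [a *: tensor_pi _]tensor_scale_pi -tensor_piD !tensor_lift_pi//.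
by rewrite linearP.
Qed.

End Tensor.

Definition tensor_map (R : comNzRingType) (M N M' N' : lmodType R)
    (f : M -> M') (g : N -> N') : tensor M N -> tensor M' N' :=
  tensor_lift (fun m n => tens (f m) (g n)).

(* A valued arrow i -> j has valuation (a, b) = varr i j with a d_j = b d_i; there is
   no arrow when a = 0 (equivalently b = 0). *)
Record vquiver (m : nat) := VQuiver {
  vval : 'I_m -> nat;
  varr : 'I_m -> 'I_m -> nat * nat;
  vval_gt0 : forall i, (0 < vval i)%N;
  varr_sym : forall i j, ((varr i j).1 * vval j = (varr i j).2 * vval i)%N
}.

Definition varrow m (Q : vquiver m) : rel 'I_m :=
  fun i j => (varr Q i j).1 != 0%N.

(* p ranges over nonempty oriented paths starting at i. *)
Definition acyclic m (Q : vquiver m) :=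
  forall i p, p != [::] -> path (varrow Q) i p -> last i p != i.

(* The full valued subquiver on the first n vertices. *)
Definition vquiver_init n p (Q : vquiver (n + p)) : vquiver n :=
  @VQuiver n (fun i => vval Q (lshift p i))
    (fun i j => varr Q (lshift p i) (lshift p j))
    (fun i => vval_gt0 Q (lshift p i))
    (fun i j => varr_sym Q (lshift p i) (lshift p j)).

(* sD i is the division algebra D_i, and sM i j the D_j-D_i-bimodule attached to the
   valued arrow i -> j (zero if there is none), of left D_j-dimension (varr i j).1 and
   right D_i-dimension (varr i j).2.  The k-linearity axioms make k act centrally. *)
Record species (k : fieldType) m (Q : vquiver m) := Species {
  sD : 'I_m -> falgType k;
  sM : 'I_m -> 'I_m -> vectType k;
  sl : forall i j, sD j -> sM i j -> sM i j;
  sr : forall i j, sM i j -> sD i -> sM i j;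
  sD_division : forall i (x : sD i), x != 0 -> x \is a GRing.unit;
  sD_dim : forall i, \dim {:sD i} = vval Q i;
  sM_dim : forall i j, \dim {:sM i j} = ((varr Q i j).1 * vval Q j)%N;
  sl_linear : forall i j x, linear (@sl i j x);
  sl_linearl : forall i j w, linear (fun x => @sl i j x w);
  sl_mul : forall i j x y w, @sl i j (x * y) w = sl x (sl y w);
  sl1 : forall i j w, @sl i j 1 w = w;
  sr_linear : forall i j w, linear (@sr i j w);
  sr_linearl : forall i j x, linear (fun w => @sr i j w x);
  sr_mul : forall i j w x y, @sr i j w (x * y) = sr (sr w x) y;
  sr1 : forall i j w, @sr i j w 1 = w;
  slr : forall i j x w y, @sr i j (sl x w) y = sl x (sr w y)
}.

Definition species_init (k : fieldType) n p (Q : vquiver (n + p))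
    (S : species k Q) : species k (vquiver_init Q) :=
  let w := lshift p in
  @Species k n (vquiver_init Q) (fun i => sD S (w i))
    (fun i j => sM S (w i) (w j)) (fun i j => @sl _ _ _ S (w i) (w j))
    (fun i j => @sr _ _ _ S (w i) (w j)) (fun i => @sD_division _ _ _ S (w i))
    (fun i => sD_dim S (w i)) (fun i j => sM_dim S (w i) (w j))
    (fun i j => @sl_linear _ _ _ S (w i) (w j))
    (fun i j => @sl_linearl _ _ _ S (w i) (w j))
    (fun i j => @sl_mul _ _ _ S (w i) (w j))
    (fun i j => @sl1 _ _ _ S (w i) (w j))
    (fun i j => @sr_linear _ _ _ S (w i) (w j))
    (fun i j => @sr_linearl _ _ _ S (w i) (w j))
    (fun i j => @sr_mul _ _ _ S (w i) (w j))
    (fun i j => @sr1 _ _ _ S (w i) (w j))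
    (fun i j => @slr _ _ _ S (w i) (w j)).

(* [quot_dim act D Z B] is the dimension of Z / B, for subgroups B <= Z of V, over the
   division ring D acting through act: the number of elements of a D-basis. *)
Section Dim.
Variables (E V : zmodType) (act : E -> V -> V).

Definition quot_basis (D : set E) (Z B : set V) r (b : 'I_r -> V) :=
  (forall s, Z (b s)) /\
  forall z, Z z -> exists! c : {ffun 'I_r -> E},
    (forall s, D (c s)) /\ B (z - \sum_s act (c s) (b s)).

Definition quot_dim (D : set E) (Z B : set V) : nat :=
  xget 0%N (fun r => exists b : 'I_r -> V, quot_basis D Z B b).
End Dim.

Section Representations.
Variables (k : finFieldType) (m : nat) (Q : vquiver m) (S : species k Q).

(* D = prod_i D_i and sM = sum_(i, j) sM i j generate the tensor algebra T_D(sM).  By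
   its universal property, a left T_D(sM)-module with underlying space k^N is an action
   of these generators satisfying [is_rep]; the unit of D_i acts as the projection onto
   the component at the vertex i. *)
Inductive gen : Type :=
| GenD i of sD S i
| GenM i j of sM S i j.
Arguments GenD : clear implicits.
Arguments GenM : clear implicits.

Record is_rep N (r : gen -> 'M[k]_N) : Prop := IsRep {
  rep_Dlin : forall i, linear (fun x => r (GenD i x));
  rep_Dmul : forall i x y, r (GenD i (x * y)) = r (GenD i x) *m r (GenD i y);
  rep_Dorth : forall i j x y, i != j -> r (GenD i x) *m r (GenD j y) = 0;
  rep_D1 : \sum_i r (GenD i 1) = 1%:M;
  rep_Mlin : forall i j, linear (fun w => r (GenM i j w));
  rep_Ml : forall i j x w, r (GenM i j (sl x w)) = r (GenD j x) *m r (GenM i j w);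
  rep_Mr : forall i j w x, r (GenM i j (sr w x)) = r (GenM i j w) *m r (GenD i x)
}.

Record rep := Rep {
  rdim : nat;
  ract :> gen -> 'M[k]_rdim;
  ractP : is_rep ract
}.

Implicit Types M N L P : rep.

Definition rephom M N : {set 'M[k]_(rdim N, rdim M)} :=
  [set f | `[< forall g, f *m M g = N g *m f >]].

Definition rephom_dim M N : nat := \dim <<enum (rephom M N)>>%VS.

Definition rep_iso M N := exists f g,
  [/\ f \in rephom M N, g \in rephom N M, g *m f = 1%:M & f *m g = 1%:M].

Lemma rephomP M N f : f \in rephom M N <-> forall g, f *m M g = N g *m f.
Proof. by rewrite inE; split=> [/asboolP|?]//; apply/asboolP. Qed.

Lemma rep_isoxx M : rep_iso M M.
Proof.
by exists 1%:M, 1%:M; rewrite !mulmx1; split=> //; apply/rephomP => g; rewrite mulmx1 mul1mx.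
Qed.

Lemma rep_iso_sym M N : rep_iso M N -> rep_iso N M.
Proof. by move=> [f [g [? ? ? ?]]]; exists g, f. Qed.

Lemma rephom_comp M N L f g : g \in rephom N L -> f \in rephom M N -> g *m f \in rephom M L.
Proof.
by move=> /rephomP Hg /rephomP Hf; apply/rephomP => x; rewrite -mulmxA Hf mulmxA Hg mulmxA.
Qed.

Lemma rep_iso_trans M N L : rep_iso M N -> rep_iso N L -> rep_iso M L.
Proof.
move=> [f [g [Hf Hg gf fg]]] [f' [g' [Hf' Hg' gf' fg']]].
exists (f' *m f), (g *m g'); split; try exact: rephom_comp.
- by rewrite -mulmxA (mulmxA g') gf' mul1mx.
- by rewrite -mulmxA (mulmxA f) fg mul1mx.
Qed.

Definition rep_isob : rel {classic rep} := fun M N => `[< rep_iso M N >].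
Lemma rep_isob_equiv : equiv_class_of rep_isob.
Proof.
split=> [M|M N|N M L]; first exact/asboolP/rep_isoxx.
  by apply/asboolP/asboolP => /rep_iso_sym.
by move=> /asboolP MN /asboolP NL; apply/asboolP/(rep_iso_trans MN NL).
Qed.
Canonical rep_isob_equiv_rel := EquivRelPack rep_isob_equiv.

Definition isorep := {eq_quot rep_isob}.
HB.instance Definition _ := Choice.on isorep.
Definition isorep_repr (a : isorep) : rep := repr a.

Definition submod M (U : {set 'cV[k]_(rdim M)}) :=
  `[< [/\ 0 \in U,
      forall a x y, x \in U -> y \in U -> a *: x + y \in U &
      forall g x, x \in U -> M g *m x \in U] >].

(* N is isomorphic to the submodule U of M, resp. to the quotient M / U. *)
Definition iso_sub M (U : {set 'cV[k]_(rdim M)}) N :=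
  `[< exists f, [/\ f \in rephom N M, injective (fun x : 'cV_(rdim N) => f *m x) &
      U = [set f *m x | x in [set: 'cV_(rdim N)]]] >].

Definition iso_quot M (U : {set 'cV[k]_(rdim M)}) N :=
  `[< exists f, [/\ f \in rephom M N, forall y : 'cV_(rdim N), exists x, f *m x = y &
      U = [set x | f *m x == 0]] >].

Definition hall_number M N L : nat :=
  #|[set U : {set 'cV[k]_(rdim L)} | [&& submod U, iso_sub U N & iso_quot U M]]|.

(* Dimension vector of a submodule U: the i-th entry is dim_(D_i) (1_i U). *)
Definition dimvec_sub M (U : {set 'cV[k]_(rdim M)}) : 'cV[int]_m :=
  \col_i (quot_dim (fun (x : sD S i) (u : 'cV_(rdim M)) => M (GenD i x) *m u)
    (fun=> True) (fun u => exists2 w, w \in U & u = M (GenD i 1) *m w) (fun u => u = 0))%:Z.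

Definition dimvec M : 'cV[int]_m := dimvec_sub [set: 'cV[k]_(rdim M)].

Definition Gr M (e : 'cV[int]_m) : {set {set 'cV[k]_(rdim M)}} :=
  [set U | submod U & dimvec_sub U == e].

Definition radical M : {set 'cV[k]_(rdim M)} :=
  \bigcap_(U | maxset (fun W => submod W && (W != setT)) U) U.

Definition top_dimvec M : 'cV[int]_m := dimvec M - dimvec_sub (radical M).

Definition projective P := forall M N g f,
  g \in rephom M N -> (forall y : 'cV_(rdim N), exists x, g *m x = y) ->
  f \in rephom P N -> exists2 h, h \in rephom P M & g *m h = f.

(* As k splits every extension of spaces, an extension of M by N lives on N (+) M with
   block triangular action.  Two of them are equivalent iff the off-diagonal blocks
   differ by a coboundary, so Ext^1(M, N) = cocycle M N / coboundary M N. *)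
Definition cocycle M N : set (gen -> 'M[k]_(rdim N, rdim M)) :=
  fun xi => is_rep (fun g => block_mx (N g) (xi g) 0 (M g)).

Definition coboundary M N : set (gen -> 'M[k]_(rdim N, rdim M)) :=
  fun xi => exists h, forall g, xi g = N g *m h - h *m M g.

(* dim_k Ext^1(M, N); then its dimension over End(N), resp. over End(M)^op. *)
Definition ext_dim M N : nat :=
  quot_dim (fun (a : k) (xi : gen -> 'M[k]_(rdim N, rdim M)) g => a *: xi g)
    (fun=> True) (@cocycle M N) (@coboundary M N).

Definition ext_diml M N : nat :=
  quot_dim (fun a (xi : gen -> 'M[k]_(rdim N, rdim M)) g => a *m xi g)
    (fun a => a \in rephom N N) (@cocycle M N) (@coboundary M N).

Definition ext_dimr M N : nat :=
  quot_dim (fun a (xi : gen -> 'M[k]_(rdim N, rdim M)) g => xi g *m a)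
    (fun a => a \in rephom M M) (@cocycle M N) (@coboundary M N).

Definition euler M N : int := (rephom_dim M N)%:Z - (ext_dim M N)%:Z.



(* Left multiplication by x on D_i, in a k-basis. *)
Definition regmx i (x : sD S i) : 'M[k]_(\dim {:sD S i}) :=
  \matrix_(a, b) coord (vbasis {:sD S i}) a (x * (vbasis {:sD S i})`_b).

Lemma regmx_linear i : linear (@regmx i).
Proof.
by move=> a x y; apply/matrixP => j l; rewrite !mxE mulrDl -scalerAl linearP.
Qed.

Lemma regmxM i (x y : sD S i) : regmx (x * y) = regmx x *m regmx y.
Proof.
apply/matrixP => j l; rewrite !mxE -mulrA.
rewrite {1}(coord_vbasis (memvf (y * _))) mulr_sumr linear_sum.
apply: eq_bigr => c _; rewrite !mxE -scalerAr linearZ /=.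
by rewrite mulrC.
Qed.

Lemma regmx1 i : regmx (1 : sD S i) = 1%:M.
Proof.
apply/matrixP => j l; rewrite !mxE mul1r coord_free//.
  by rewrite eq_sym.
exact: basis_free (vbasisP _).
Qed.

(* The simple module S_i is D_i at the vertex i, with every bimodule acting by 0. *)
Definition simple_act i (g : gen) : 'M[k]_(\dim {:sD S i}) :=
  match g with
  | GenD j x => untag 0 (@regmx i) (Tagged (sD S) x)
  | GenM _ _ _ => 0
  end.

Lemma simple_actE i x : simple_act i (GenD i x) = regmx x.
Proof. by rewrite /= (untagE _ _ (erefl i : tag (Tagged (sD S) x) = i)). Qed.

Lemma simple_act0 i j x : j != i -> simple_act i (GenD j x) = 0.
Proof. by move=> ji; rewrite /= untag_dflt. Qed.

Lemma simple_rep i : is_rep (simple_act i).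
Proof.
split=> [j|j x y|j l x y jl||j l a x y|j l x w|j l w x].
- case: (eqVneq j i) => [->|ji] a x y.
    by rewrite !simple_actE regmx_linear.
  by rewrite !simple_act0// scaler0 addr0.
- case: (eqVneq j i) x y => [->|ji] x y.
    by rewrite !simple_actE regmxM.
  by rewrite !simple_act0// mul0mx.
- case: (eqVneq j i) x => [ji|ji] x; last by rewrite simple_act0// mul0mx.
  by rewrite (simple_act0 y) ?mulmx0//; rewrite -ji eq_sym.
- rewrite (bigD1 i)//= big1 ?addr0; first by rewrite -regmx1 -simple_actE.
  by move=> j ji; exact: simple_act0.
- by rewrite /= scaler0 addr0.
- by rewrite /= mulmx0.
- by rewrite /= mul0mx.
Qed.

Definition simple_at i : rep := Rep (simple_rep i).

(* The bilinear form induced on K(A) = Z^m by euler: K(A) is free on the classes of the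
   simples, whose dimension vectors are the unit vectors. *)
Definition eulerv (a b : 'cV[int]_m) : int :=
  \sum_i \sum_j a i 0 * b j 0 * euler (simple_at i) (simple_at j).

Lemma zero_rep_subproof : is_rep (fun=> 0 : 'M[k]_0).
Proof. by split; repeat move=> ?; apply/matrixP => -[]. Qed.
Definition zero_rep : rep := Rep zero_rep_subproof.

Lemma dsum_rep_subproof M N :
  is_rep (fun g => block_mx (M g) 0 0 (N g)).
Proof.
have [Ml Mm Mo M1 Ml' MMl MMr] := ractP M; have [Nl Nm No N1 Nl' NMl NMr] := ractP N.
split=> [i a x y|i x y|i j x y ij||i j a x y|i j x w|i j w x].
- by rewrite Ml Nl scale_block_mx add_block_mx !scaler0 !addr0.
- by rewrite mulmx_block !(mul0mx, mulmx0, addr0, add0r) Mm Nm.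
- by rewrite mulmx_block !(mul0mx, mulmx0, addr0, add0r) Mo// No// block_mx0.
- rewrite scalar_mx_block -M1 -N1.
  elim/big_rec3: _ => [|i ? ? ? _ ->]; first by rewrite block_mx0.
  by rewrite add_block_mx !addr0.
- by rewrite Ml' Nl' scale_block_mx add_block_mx !scaler0 !addr0.
- by rewrite mulmx_block !(mul0mx, mulmx0, addr0, add0r) MMl NMl.
- by rewrite mulmx_block !(mul0mx, mulmx0, addr0, add0r) MMr NMr.
Qed.
Definition dsum_rep M N : rep := Rep (dsum_rep_subproof M N).

Lemma projective0 : projective zero_rep.
Proof.
move=> M N g f _ _ _; exists 0; last by apply/matrixP => ? -[].
by apply/rephomP => x; apply/matrixP => ? -[].
Qed.

Record projrep := ProjRep { prep :> rep; prepP : projective prep }.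

Definition proj0 : projrep := ProjRep projective0.

(* Morphisms M_(-1) -> M_0, with M_(-1) = asrc and M_0 = atgt.  amap is only required
   to be a module morphism for the objects [c2p] of C_2(P). *)
Record arr := Arr {
  asrc : rep;
  atgt : rep;
  amap : 'M[k]_(rdim atgt, rdim asrc)
}.

Definition arr_hom (X Y : arr) :
    {set 'M[k]_(rdim (asrc Y), rdim (asrc X)) * 'M[k]_(rdim (atgt Y), rdim (atgt X))} :=
  [set f | [&& f.1 \in rephom (asrc X) (asrc Y), f.2 \in rephom (atgt X) (atgt Y) &
      f.2 *m amap X == amap Y *m f.1]].

Definition arr_iso (X Y : arr) := exists f g,
  [/\ f \in arr_hom X Y, g \in arr_hom Y X,
      g.1 *m f.1 = 1%:M /\ g.2 *m f.2 = 1%:M &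
      f.1 *m g.1 = 1%:M /\ f.2 *m g.2 = 1%:M].

Record c2p := C2P {
  c2arr :> arr;
  c2srcP : projective (asrc c2arr);
  c2tgtP : projective (atgt c2arr);
  c2mapP : amap c2arr \in rephom (asrc c2arr) (atgt c2arr)
}.

Lemma arr_isoxx (X : arr) : arr_iso X X.
Proof.
exists (1%:M, 1%:M), (1%:M, 1%:M); rewrite /= !mulmx1.
by split=> //; rewrite inE /= mulmx1 mul1mx eqxx andbT; apply/andP; split;
  apply/rephomP => g; rewrite mulmx1 mul1mx.
Qed.

Lemma arr_iso_sym X Y : arr_iso X Y -> arr_iso Y X.
Proof. by move=> [f [g [? ? ? ?]]]; exists g, f. Qed.

Lemma arr_iso_trans X Y Z : arr_iso X Y -> arr_iso Y Z -> arr_iso X Z.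
Proof.
have comp A B C f g : g \in arr_hom B C -> f \in arr_hom A B ->
    (g.1 *m f.1, g.2 *m f.2) \in arr_hom A C.
  rewrite ![_ \in arr_hom _ _]inE => /and3P[g1 g2 /eqP gE] /and3P[f1 f2 /eqP fE] /=.
  by rewrite (rephom_comp g1)// (rephom_comp g2)//= -mulmxA fE !mulmxA gE.
move=> [f [g [Hf Hg [gf1 gf2] [fg1 fg2]]]] [f' [g' [Hf' Hg' [gf1' gf2'] [fg1' fg2']]]].
exists (f'.1 *m f.1, f'.2 *m f.2), (g.1 *m g'.1, g.2 *m g'.2).
split; try exact: comp; split=> /=.
- by rewrite -mulmxA (mulmxA g'.1) gf1' mul1mx.
- by rewrite -mulmxA (mulmxA g'.2) gf2' mul1mx.
- by rewrite -mulmxA (mulmxA f.1) fg1 mul1mx.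
- by rewrite -mulmxA (mulmxA f.2) fg2 mul1mx.
Qed.

Definition c2p_isob : rel {classic c2p} := fun X Y => `[< arr_iso (X : c2p) (Y : c2p) >].
Lemma c2p_isob_equiv : equiv_class_of c2p_isob.
Proof.
split=> [X|X Y|Y X Z]; first exact/asboolP/arr_isoxx.
  by apply/asboolP/asboolP => /arr_iso_sym.
by move=> /asboolP XY /asboolP YZ; apply/asboolP/(arr_iso_trans XY YZ).
Qed.
Canonical c2p_isob_equiv_rel := EquivRelPack c2p_isob_equiv.

Definition isoc2p := {eq_quot c2p_isob}.
HB.instance Definition _ := Choice.on isoc2p.
Definition isoc2p_repr (a : isoc2p) : c2p := repr a.
Definition isoc2p_class (X : c2p) : isoc2p := \pi_isoc2p (X : {classic c2p}).

(* Ext^1(X, Y) in C_2(P).  Extensions split degreewise because the terms of X are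
   projective, so the middle term is Y_(-1) (+) X_(-1) -> Y_0 (+) X_0 with matrix
   [[amap Y, xi], [0, amap X]], xi in Hom(X_(-1), Y_0).  Equivalence is congruence modulo
   [arr_bound], so [arr_ext] is the set of cosets. *)
Definition arr_bound (X Y : arr) : {set 'M[k]_(rdim (atgt Y), rdim (asrc X))} :=
  [set amap Y *m h.1 + h.2 *m amap X |
     h in setX (rephom (asrc X) (asrc Y)) (rephom (atgt X) (atgt Y))].

Definition arr_ext (X Y : arr) : {set {set 'M[k]_(rdim (atgt Y), rdim (asrc X))}} :=
  [set [set xi + b | b in arr_bound X Y] | xi in rephom (asrc X) (atgt Y)].

Definition arr_mid (X Y : arr) (xi : 'M[k]_(rdim (atgt Y), rdim (asrc X))) : arr :=
  @Arr (dsum_rep (asrc Y) (asrc X)) (dsum_rep (atgt Y) (atgt X))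
    (block_mx (amap Y) xi 0 (amap X)).

Definition arr_ext_mid (X Y L : arr) :=
  [set c in arr_ext X Y | `[< exists2 xi, xi \in c & arr_iso (arr_mid xi) L >]].

(* dim Hom(X, Y) - dim Ext^1(X, Y). *)
Definition arr_euler (X Y : arr) : int :=
  (\dim <<enum (arr_hom X Y)>>%VS)%:Z -
  ((\dim <<enum (rephom (asrc X) (atgt Y))>>%VS)%:Z - (\dim <<enum (arr_bound X Y)>>%VS)%:Z).

Lemma c2p_K_subproof (P : projrep) : (1%:M : 'M[k]_(rdim P)) \in rephom P P.
Proof. by apply/rephomP => g; rewrite mulmx1 mul1mx. Qed.
Definition c2p_K (P : projrep) : c2p :=
  @C2P (@Arr P P 1%:M) (@prepP P) (@prepP P) (c2p_K_subproof P).

Lemma c2p_Z_subproof (P : projrep) : (0 : 'M[k]_(0, rdim P)) \in rephom P zero_rep.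
Proof. by apply/rephomP => g; rewrite mul0mx mulmx0. Qed.
Definition c2p_Z (P : projrep) : c2p :=
  @C2P (@Arr P zero_rep 0) (@prepP P) projective0 (c2p_Z_subproof P).

(* X is a minimal projective resolution of M, f being the augmentation. *)
Definition min_proj_res M (X : c2p) := exists f,
  [/\ f \in rephom (atgt X) M,
      forall y : 'cV_(rdim M), exists x, f *m x = y,
      injective (fun x : 'cV_(rdim (asrc X)) => amap X *m x),
      [set x | f *m x == 0]
        = [set amap X *m x | x in [set: 'cV_(rdim (asrc X))]] &
      [set x | f *m x == 0] \subset radical (atgt X)].

(* The default value of xget is irrelevant: minimal projective resolutions exist. *)
Definition c2p_C M : c2p :=
  xget (c2p_Z proj0 : {classic c2p}) (@min_proj_res M).

End Representations.

(* The algebra T_Lam: the free module on the X^a with the twisted product below. *)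
Definition qtorus (k : finFieldType) m (Lam : 'M[int]_m) : Type :=
  {malg (laurent k)['cV[int]_m]}.
HB.instance Definition _ k m (Lam : 'M[int]_m) := GRing.Lmodule.on (qtorus k Lam).

Section QuantumTorus.
Variables (k : finFieldType) (m : nat) (Lam : 'M[int]_m).

Definition mxform (a b : 'cV[int]_m) : int := (a^T *m Lam *m b) 0 0.

Lemma mxformDl a b c : mxform (a + b) c = mxform a c + mxform b c.
Proof. by rewrite /mxform linearD !mulmxDl mxE. Qed.
Lemma mxformDr a b c : mxform a (b + c) = mxform a b + mxform a c.
Proof. by rewrite /mxform mulmxDr mxE. Qed.
Lemma mxform0l a : mxform 0 a = 0.
Proof. by rewrite /mxform linear0 !mul0mx mxE. Qed.
Lemma mxform0r a : mxform a 0 = 0.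
Proof. by rewrite /mxform mulmx0 mxE. Qed.

Local Notation qtorus := (qtorus k Lam).

Definition qtorus_X (a : 'cV[int]_m) : qtorus := << a >>.

Definition qtorus_mul : qtorus -> qtorus -> qtorus :=
  bilin_ext (fun a b => vq k ^ mxform a b *: qtorus_X (a + b)).

Lemma qtorus_mulX a b :
  qtorus_mul (qtorus_X a) (qtorus_X b) = vq k ^ mxform a b *: qtorus_X (a + b).
Proof. exact: bilin_extU. Qed.

Lemma qtorus_mulPl c x x' y :
  qtorus_mul (c *: x + x') y = c *: qtorus_mul x y + qtorus_mul x' y.
Proof. exact: bilin_extPl. Qed.
Lemma qtorus_mulPr c x y y' :
  qtorus_mul x (c *: y + y') = c *: qtorus_mul x y + qtorus_mul x y'.
Proof. exact: bilin_extPr. Qed.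

Lemma qtorus_mulZl c x y : qtorus_mul (c *: x) y = c *: qtorus_mul x y.
Proof. by apply: (scalable_linear (f := qtorus_mul^~ y)) => ? ? ?; exact: qtorus_mulPl. Qed.
Lemma qtorus_mulZr c x y : qtorus_mul x (c *: y) = c *: qtorus_mul x y.
Proof. by apply: (scalable_linear (f := qtorus_mul x)) => ? ? ?; exact: qtorus_mulPr. Qed.

Lemma eq_linear_qtorus (V : lmodType (laurent k)) (f g : qtorus -> V) :
  linear f -> linear g -> (forall a, f (qtorus_X a) = g (qtorus_X a)) -> f =1 g.
Proof. exact: eq_linear_malg. Qed.

Fact qtorus_1_neq0 : qtorus_X 0 != 0.
Proof. by rewrite /qtorus_X monalgU_eq0 oner_neq0. Qed.

Local Opaque qtorus_X qtorus_mul.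

Fact qtorus_mulA : associative qtorus_mul.
Proof.
have basis a b d : qtorus_mul (qtorus_X a) (qtorus_mul (qtorus_X b) (qtorus_X d)) =
    qtorus_mul (qtorus_mul (qtorus_X a) (qtorus_X b)) (qtorus_X d).
  apply: etrans (congr1 (qtorus_mul (qtorus_X a)) (qtorus_mulX b d)) _.
  apply: etrans (qtorus_mulZr _ _ _) _.
  apply: etrans (congr1 ( *:%R _) (qtorus_mulX a (b + d))) _.
  apply/esym; apply: etrans (congr1 (qtorus_mul^~ (qtorus_X d)) (qtorus_mulX a b)) _.
  apply: etrans (qtorus_mulZl _ _ _) _.
  apply: etrans (congr1 ( *:%R _) (qtorus_mulX (a + b) d)) _.
  apply: etrans (scalerA _ _ _) _; apply/esym; apply: etrans (scalerA _ _ _) _.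
  have -> : vq k ^ mxform b d * vq k ^ mxform a (b + d) =
      vq k ^ mxform a b * vq k ^ mxform (a + b) d.
    by rewrite -!exprzDr ?vq_unit// mxformDl mxformDr addrC addrA.
  exact: (congr1 (fun u => _ *: qtorus_X u) (addrA a b d)).
move=> x y z; move: x.
apply: (eq_linear_qtorus (f := fun x => qtorus_mul x _)
  (g := fun x => qtorus_mul (qtorus_mul x _) _)) => [c x x'|c x x'|a].
- by rewrite qtorus_mulPl.
- by rewrite (qtorus_mulPl c x) qtorus_mulPl.
move: y; apply: (eq_linear_qtorus (f := fun y => qtorus_mul _ (qtorus_mul y _))
  (g := fun y => qtorus_mul (qtorus_mul _ y) _)) => [c y y'|c y y'|b].
- by rewrite (qtorus_mulPl c y) qtorus_mulPr.
- by rewrite (qtorus_mulPr c _ y) qtorus_mulPl.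
move: z; apply: (eq_linear_qtorus (f := fun z => qtorus_mul _ (qtorus_mul _ z))
  (g := fun z => qtorus_mul (qtorus_mul _ _) z)) => [c z z'|c z z'|d].
- exact: etrans (congr1 (qtorus_mul _) (qtorus_mulPr c _ z z')) (qtorus_mulPr _ _ _ _).
- by rewrite qtorus_mulPr.
exact: basis.
Qed.

Fact qtorus_mul1l : left_id (qtorus_X 0) qtorus_mul.
Proof.
apply: (eq_linear_qtorus (f := fun x => qtorus_mul _ x)) => [c x y||a].
  exact: qtorus_mulPr.
  by move=> c x y.
by rewrite qtorus_mulX mxform0l expr0z scale1r add0r.
Qed.

Fact qtorus_mul1r : right_id (qtorus_X 0) qtorus_mul.
Proof.
apply: (eq_linear_qtorus (f := fun x => qtorus_mul x _)) => [c x y||a].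
  exact: qtorus_mulPl.
  by move=> c x y.
by rewrite qtorus_mulX mxform0r expr0z scale1r addr0.
Qed.

Fact qtorus_mulDl : left_distributive qtorus_mul +%R.
Proof. by move=> x y z; rewrite -[x]scale1r qtorus_mulPl !scale1r. Qed.

Fact qtorus_mulDr : right_distributive qtorus_mul +%R.
Proof. by move=> x y z; rewrite -[y]scale1r qtorus_mulPr !scale1r. Qed.

HB.instance Definition _ := GRing.Zmodule_isNzRing.Build qtorus
  qtorus_mulA qtorus_mul1l qtorus_mul1r qtorus_mulDl qtorus_mulDr qtorus_1_neq0.

Fact qtorus_scalerAl (c : laurent k) (x y : qtorus) : c *: (x * y) = (c *: x) * y.
Proof. exact/esym/qtorus_mulZl. Qed.
HB.instance Definition _ :=
  GRing.Lmodule_isLalgebra.Build (laurent k) qtorus qtorus_scalerAl.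

Fact qtorus_scalerAr (c : laurent k) (x y : qtorus) : c *: (x * y) = x * (c *: y).
Proof. exact/esym/qtorus_mulZr. Qed.
HB.instance Definition _ :=
  GRing.Lalgebra_isAlgebra.Build (laurent k) qtorus qtorus_scalerAr.

End QuantumTorus.
Arguments qtorus_X {k m} Lam a.

Section HallAlgebra.
Variables (k : finFieldType) (m : nat) (Q : vquiver m) (S : species k Q).

Definition hall_alg : Type := {malg (laurent k)[isoc2p S]}.
HB.instance Definition _ := GRing.Lmodule.on hall_alg.

Definition hall_class (X : c2p S) : hall_alg := << isoc2p_class X >>.

Definition hall_mul_basis (a b : isoc2p S) : hall_alg :=
  let X := isoc2p_repr a in let Y := isoc2p_repr b in
  (#|k|%:R : laurent k) ^ arr_euler X Y *:
    \sum_(c \in [set: isoc2p S]%classic)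
      (#|arr_ext_mid X Y (isoc2p_repr c)|%:R / #|arr_hom X Y|%:R) *:
        hall_class (isoc2p_repr c).

Definition hall_mul : hall_alg -> hall_alg -> hall_alg := bilin_ext hall_mul_basis.

(* MH is the localization of the Hall algebra at the central elements [K_P].  These are
   closed under products, [K_P] * [K_P'] = [K_(P (+) P')], so one denominator suffices;
   the unit of the Hall algebra is the class of 0 -> 0. *)
Record is_localization (MH : algType (laurent k)) (iota : {linear hall_alg -> MH}) :
    Prop := IsLocalization {
  loc_1 : iota (hall_class (c2p_Z (proj0 S))) = 1;
  loc_mul : forall x y, iota (hall_mul x y) = iota x * iota y;
  loc_inv : forall P : projrep S, exists y,
    y * iota (hall_class (c2p_K P)) = 1 /\ iota (hall_class (c2p_K P)) * y = 1;
  loc_surj : forall z, exists (P : projrep S) x,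
    iota (hall_class (c2p_K P)) * z = iota x;
  loc_ker : forall x, iota x = 0 ->
    exists P : projrep S, hall_mul (hall_class (c2p_K P)) x = 0
}.

Section Elements.
Variables (MH : algType (laurent k)) (iota : {linear hall_alg -> MH}).
Variable K : 'cV[int]_m -> MH.

Definition XM (M : rep S) : MH :=
  K (- dimvec (atgt (c2p_C M))) * iota (hall_class (c2p_C M)).

Definition XP (P : projrep S) : MH := iota (hall_class (c2p_Z P)).

Definition XMP (M : rep S) (P : projrep S) : MH := XM M * XP P.

Definition is_K := forall P P' : projrep S,
  K (dimvec P - dimvec P') * iota (hall_class (c2p_K P')) = iota (hall_class (c2p_K P)).

Definition is_Delta (Delta : MH -> tensor MH MH) :=
  forall (a : 'cV[int]_m) (L : rep S) (P : projrep S),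
  Delta (K a * XMP L P) =
    \sum_(c \in [set: isorep S * isorep S]%classic)
      let M := isorep_repr c.1 in let N := isorep_repr c.2 in
      ((#|k|%:R : laurent k) ^ eulerv S (dimvec M) (dimvec N - dimvec P)
        * (hall_number M N L)%:R) *: tens (XM M) (K a * XMP N P).

Definition is_int (intg : MH -> {malg (laurent k)['cV[int]_(m + m)]}) :=
  forall (a : 'cV[int]_m) (M : rep S) (P : projrep S),
  intg (K a * XMP M P) =
    << col_mx 0 a + col_mx (dimvec M) 0 - col_mx (dimvec P) 0 >>.

End Elements.
End HallAlgebra.

Section Character.
Variables (k : finFieldType) (n : nat) (Qt : vquiver (n + n)) (St : species k Qt).
Variable Lam : 'M[int]_(n + n).

(* The matrices R, R', I, B, E, E' (all with a tilde), where the first n of the n + n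
   vertices are those of Q. *)
Definition Rt : 'M[int]_(n + n, n) :=
  \matrix_(i, j) (ext_diml (simple_at St (lshift n j)) (simple_at St i))%:Z.
Definition Rt' : 'M[int]_(n + n, n) :=
  \matrix_(i, j) (ext_dimr (simple_at St i) (simple_at St (lshift n j)))%:Z.
Definition It : 'M[int]_(n + n, n) := col_mx 1%:M 0.
Definition Bt := Rt' - Rt.
Definition Et := It - Rt'.
Definition Et' := It - Rt.

Definition compatible :=
  Lam^T = - Lam /\
  Lam *m (- Bt) = col_mx (diag_mx (\row_i (vval Qt (lshift n i))%:Z)) 0.

Local Notation S := (species_init St).
Local Notation T := {malg (laurent k)['cV[int]_(n + n)]}.

Definition mu_basis (a b : 'cV[int]_(n + n)) : qtorus k Lam :=
  let a1 := usubmx a in let a2 := dsubmx a in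
  let b1 := usubmx b in let b2 := dsubmx b in
  vq k ^ (- (eulerv S a1 b1 + eulerv S b1 a1) - eulerv S a1 b1) *:
    qtorus_X Lam (- (Et *m a1) - Et' *m b1 + col_mx 0 a2 + col_mx 0 b2).

Definition mu_T : tensor T T -> qtorus k Lam := tensor_lift (bilin_ext mu_basis).

Definition Psi (MH : algType (laurent k)) (Delta : MH -> tensor MH MH)
    (intg : MH -> T) : MH -> qtorus k Lam :=
  fun z => mu_T (tensor_map intg intg (Delta z)).

Definition cluster_char (M P : rep S) : qtorus k Lam :=
  \sum_(e \in [set: 'cV[int]_n]%classic)
    (vq k ^ eulerv S (dimvec P - e) (dimvec M - e) * #|Gr M e|%:R) *:
      qtorus_X Lam (- (Bt *m e) - Et *m dimvec M + col_mx (top_dimvec P) 0).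

End Character.

(* Main.v *)
From HB Require Import structures.
Require Import Defs.
From mathcomp Require Import all_boot all_order all_algebra.
From mathcomp Require Import falgebra finmap monalg.
From mathcomp Require Import finfield ring.
From mathcomp Require Import boolp classical_sets fsbigop.
From mathcomp Require Import finset.

Set Implicit Arguments.
Unset Strict Implicit.
Unset Printing Implicit Defensive.

Import GRing.Theory.
Local Open Scope ring_scope.

(** Both sides are one and the same sum over the submodules U of M.

    The coefficient of X_L (x) X_(N (+) P[1]) in Delta(X_(M (+) P[1])) contains
    the Hall number F_(LN)^M, which counts the submodules U of M with U = N and
    M / U = L up to isomorphism.  Every U determines the two classes, so summing
    over pairs of classes with weight F_(LN)^M amounts to summing over U
    ([hall_number_fibre], [fsum_card_fibre]).  Likewise summing over e with
    weight |Gr_e M| amounts to summing over U.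

    It remains to compare the terms at U.  With e the dimension vector of U,
    additivity gives dim N = e and dim L = m - e ([dimvec_iso_sub],
    [dimvec_iso_quot]), and the two contributions to the power of v combine to
    v^(2<m-e, e-p> - (m-e, e-p) - <m-e, e-p>) = v^(-<e-p, m-e>)
    = v^<p-e, m-e>, while the exponent of X becomes
    -E(m - e) - E'(e - p) = -(E' - E)e - Em + E'p.  Here E' - E = B, and the
    hypothesis on P says that E'p = t_P.

    Additivity of dimension vectors comes from counting.  The component of a
    module at the vertex i is a free module over the finite division algebra
    D_i, so its cardinality is a power of q^(d_i) whose exponent is its
    dimension ([card_quot_dim], [card_component]); cardinalities are
    multiplicative in exact sequences.  That U and M / U are again
    representations is seen on matrices, by compressing the action of M along a
    split injection or a split surjection ([compress]). *)

(** * Dimension over a finite division algebra *)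

Section DivisionModule.
Variables (k : finFieldType) (E : falgType k) (V : finZmodType).
Variables (act : E -> V -> V) (Z : {set V}).
Hypothesis E_division : forall x : E, x != 0 -> x \is a GRing.unit.
Hypothesis actDl : forall u, {morph act^~ u : x y / x + y}.
Hypothesis actDr : forall x, {morph act x : u w / u + w}.
Hypothesis actA : forall x y u, act (x * y) u = act x (act y u).
Hypothesis act1 : forall u, u \in Z -> act 1 u = u.
Hypothesis Z0 : 0 \in Z.
Hypothesis ZD : forall u w, u \in Z -> w \in Z -> u + w \in Z.
Hypothesis Zact : forall x u, u \in Z -> act x u \in Z.

(* [finvect_type E] is E with the finite type structure that comes from k. *)
Local Notation coefs r := {ffun 'I_r -> finvect_type E}.
Let comb r (b : 'I_r -> V) (c : coefs r) : V := \sum_s act (c s) (b s).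
Let is_free r (b : 'I_r -> V) :=
  (forall s, b s \in Z) /\ forall c, comb b c = 0 -> c = 0.
Let Eof (x : finvect_type E) : E := x.

Let act0l u : act 0 u = 0.
Proof. by apply: (addrI (act 0 u)); rewrite -actDl !addr0. Qed.

Let act0r x : act x 0 = 0.
Proof. by apply: (addrI (act x 0)); rewrite -actDr !addr0. Qed.

Let actNl x u : act (- x) u = - act x u.
Proof. by apply: (addrI (act x u)); rewrite -actDl !subrr act0l. Qed.

Let comb_in r (b : 'I_r -> V) c : (forall s, b s \in Z) -> comb b c \in Z.
Proof. by move=> bZ; rewrite /comb; elim/big_ind: _ => // s _; apply: Zact. Qed.

Let combB r (b : 'I_r -> V) c d : comb b (c - d) = comb b c - comb b d.
Proof.
rewrite /comb -sumrB; apply: eq_bigr => s _.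
by rewrite !ffunE actDl -actNl.
Qed.

Let comb_inj r (b : 'I_r -> V) : is_free b -> injective (comb b).
Proof.
move=> [_ b0] c d cd; apply/eqP; rewrite -subr_eq0; apply/eqP; apply: b0.
by rewrite combB cd subrr.
Qed.

Let card_coefs r : #|{: coefs r}| = ((#|k| ^ \dim {:E}) ^ r)%N.
Proof.
rewrite card_ffun card_ord; congr (_ ^ _)%N.
transitivity #|(fullv : {vspace finvect_type E})|; last exact: card_vspace.
by apply: eq_card => x; rewrite memvf.
Qed.

Let card_E_gt1 : (1 < #|k| ^ \dim {:E})%N.
Proof.
rewrite -[1%N](expn0 #|k|) ltn_exp2l ?card_finRing_gt1//.
exact: adim_gt0.
Qed.

Let comb_scale r (b : 'I_r -> V) x (c : coefs r) :
  act x (comb b c) = comb b [ffun s => x * Eof (c s)].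
Proof.
rewrite /comb (big_morph _ (actDr x) (act0r x)); apply: eq_bigr => s _.
by rewrite ffunE actA.
Qed.

(** A longest free family spans: an element outside the span could be added
    to it, because nonzero scalars are invertible.  Families are bounded in length
    since a free family of length r embeds E^r in the finite set Z. *)
Let free_basis : exists r (b : 'I_r -> V), is_free b /\
  forall u, u \in Z -> exists c, comb b c = u.
Proof.
pose P r := `[< exists b : 'I_r -> V, is_free b >].
have exP : exists r, P r.
  exists 0%N; apply/asboolP; exists (fun=> 0); split=> // c _.
  by apply/ffunP => -[].
have ubP r : P r -> (r <= #|Z|)%N.
  move=> /asboolP[b bfree]; apply/ltnW/(leq_trans (ltn_expl r card_E_gt1)).
  rewrite -card_coefs -(card_imset _ (comb_inj bfree)); apply: subset_leq_card.
  by apply/fintype.subsetP => _ /imsetP[c _ ->]; apply: comb_in; case: bfree.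
case: (ex_maxnP exP ubP) => r /asboolP[b bfree] rmax; exists r, b; split=> // u uZ.
apply: contrapT => nu; suff /rmax : P r.+1 by rewrite ltnn.
apply/asboolP; exists (fun i => if unlift ord0 i is Some j then b j else u).
split=> [s|c]; first by case: unlift => // j; case: bfree.
rewrite /comb big_ord_recl unlift_none.
under eq_bigr do rewrite liftK.
pose c' : coefs r := [ffun j => c (lift ord0 j)].
have -> : \sum_(i < r) act (c (lift ord0 i)) (b i) = comb b c'.
  by apply: eq_bigr => i _; rewrite ffunE.
have [c0|c0] := eqVneq (c ord0 : E) 0.
  rewrite c0 act0l add0r => /(proj2 bfree) c'0; apply/ffunP => i; rewrite ffunE.
  case: (unliftP ord0 i) => [j|] ->; last exact: c0.
  by have := congr1 (fun f : coefs r => f j) c'0; rewrite !ffunE.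
move=> cu; case: nu; exists [ffun s => - (c ord0 : E)^-1 * Eof (c' s)].
have {cu} cE : comb b c' = act (- (c ord0 : E)) u.
  by apply/eqP; rewrite actNl -addr_eq0 addrC cu.
by rewrite -comb_scale cE -actA mulrNN mulVr ?E_division// act1.
Qed.

(** A basis of length r identifies Z with E^r.  As E has more than one element,
    this pins down the value of [quot_dim], and turns statements about
    dimensions into counting. *)
Lemma card_quot_dim :
  #|Z| = ((#|k| ^ \dim {:E}) ^
          quot_dim act (fun=> True) (fun u => u \in Z) (fun u => u = 0%R))%N.
Proof.
rewrite /quot_dim; case: xgetP => [r _ [b [bZ bP]]|/= nr]; last first.
  have [r [b [bfree bspan]]] := free_basis.
  case: (nr r); exists b; split=> [|u uZ]; first by case: bfree.
  have [c cu] := bspan u uZ; exists c; split=> [|d [_ du]].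
    by split=> //; rewrite -cu /comb subrr.
  apply: (comb_inj bfree); rewrite cu; apply/eqP; rewrite -subr_eq0.
  exact/eqP.
have inj : injective (comb b).
  move=> c d cd; have /= [c1 [_ uniq]] := bP _ (comb_in c bZ).
  rewrite -(uniq c); last by split=> //; exact: subrr.
  by rewrite -(uniq d)//; split=> //; rewrite cd; exact: subrr.
rewrite -card_coefs -(card_imset _ inj); apply: eq_card => u.
apply/idP/imsetP => [/bP[c [[_ /eqP]]]|[c _ ->]]; last exact: comb_in.
by rewrite subr_eq0 => /eqP uE _; exists c.
Qed.
End DivisionModule.

(** * Dimension vectors of submodules and quotients *)

Section Submodules.
Variables (k : finFieldType) (m : nat) (Q : vquiver m) (S : species k Q).
Implicit Types L M N : rep S.
Local Notation idem i := (@GenD k m Q S i 1).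


Definition component M i (U : {set 'cV[k]_(rdim M)}) : {set 'cV[k]_(rdim M)} :=
  [set M (idem i) *m w | w in U].

Lemma submodT M : submod [set: 'cV[k]_(rdim M)].
Proof. by apply/asboolP; split=> *; rewrite inE. Qed.

Lemma component_act M i x (U : {set 'cV[k]_(rdim M)}) u :
  submod U -> u \in component i U -> M (@GenD k m Q S i x) *m u \in component i U.
Proof.
move=> /asboolP[_ _ Ug] /imsetP[w wU ->]; apply/imsetP.
exists (M (GenD x) *m w); first exact: Ug.
by rewrite !mulmxA -!(rep_Dmul (ractP M)) mulr1 mul1r.
Qed.

Lemma component_id M i (U : {set 'cV[k]_(rdim M)}) u :
  u \in component i U -> M (idem i) *m u = u.
Proof. by move=> /imsetP[w _ ->]; rewrite mulmxA -(rep_Dmul (ractP M)) mulr1. Qed.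

(** The unit of D_i is the projection onto the component at i, so it acts there
    as the identity and the component is a genuine D_i-space. *)
Lemma card_component M i (U : {set 'cV[k]_(rdim M)}) : submod U ->
  #|component i U| = ((#|k| ^ vval Q i) ^ `|dimvec_sub U i 0%R|)%N.
Proof.
move=> subU; have [U0 UP Ug] := asboolW subU; rewrite mxE absz_nat -(sD_dim S).
pose act (x : sD S i) (u : 'cV[k]_(rdim M)) := M (GenD x) *m u.
have -> : (fun u => exists2 w, w \in U & u = M (idem i) *m w) =
    (fun u => u \in component i U).
  by apply/funext => u; apply/propext; split=> /imsetP.
have Dlin := @rep_Dlin _ _ _ _ _ _ (ractP M) i.
have actDl u : {morph act^~ u : x y / x + y}.
  by move=> x y; rewrite /act -[x]scale1r Dlin !scale1r mulmxDl.
have actDr x : {morph act x : u w / u + w} by move=> u w; exact: mulmxDr.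
have actA x y u : act (x * y) u = act x (act y u).
  by rewrite /act (rep_Dmul (ractP M)) mulmxA.
apply: etrans (card_quot_dim (@sD_division _ _ _ S i) actDl actDr actA _ _ _ _) _.
- by move=> u; exact: component_id.
- by apply/imsetP; exists 0; rewrite ?mulmx0.
- move=> _ _ /imsetP[u uU ->] /imsetP[w wU ->]; apply/imsetP; exists (u + w).
    by rewrite -[u]scale1r UP.
  by rewrite mulmxDr.
- by move=> x u; exact: component_act.
by [].
Qed.

Lemma absz_dimvec_sub M i (U : {set 'cV[k]_(rdim M)}) :
  (`|dimvec_sub U i 0%R|%N)%:Z = dimvec_sub U i 0.
Proof. by rewrite mxE absz_nat. Qed.

Lemma expn_card_inj i : injective (expn (#|k| ^ vval Q i)).
Proof.
by apply: expnI; rewrite -[1%N](expn0 #|k|) ltn_exp2l ?card_finRing_gt1// vval_gt0.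
Qed.

Lemma dimvec_iso_sub M N (U : {set 'cV[k]_(rdim M)}) : submod U -> iso_sub U N ->
  dimvec N = dimvec_sub U.
Proof.
move=> subU /asboolP[f [/rephomP fhom finj UE]]; apply/colP => i.
rewrite /dimvec -(absz_dimvec_sub i setT) -(absz_dimvec_sub i U).
apply: (congr1 Posz); apply: (@expn_card_inj i).
rewrite -!card_component ?submodT// -(card_imset _ finj); apply: eq_card => u.
apply/imsetP/imsetP => [[_ /imsetP[w _ ->] ->]|[v + ->]].
  by exists (f *m w); rewrite ?UE ?imset_f// !mulmxA fhom.
rewrite UE => /imsetP[w _ ->]; exists (N (idem i) *m w); first by rewrite imset_f.
by rewrite !mulmxA fhom.
Qed.

(** At each vertex, the fibres of the component of M over that of N are the
    translates of the component of the kernel U. *)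
Lemma dimvec_iso_quot M N (U : {set 'cV[k]_(rdim M)}) : submod U -> iso_quot U N ->
  dimvec M = dimvec_sub U + dimvec N.
Proof.
move=> subU /asboolP[f [/rephomP fhom fsurj UE]]; apply/colP => i.
have [U0 UP Ug] := asboolW subU.
rewrite [RHS]mxE /dimvec -(absz_dimvec_sub i U).
rewrite -(absz_dimvec_sub i [set: 'cV[k]_(rdim M)]).
rewrite -(absz_dimvec_sub i [set: 'cV[k]_(rdim N)]).
apply: (congr1 Posz); apply: (@expn_card_inj i).
rewrite expnD -!card_component ?submodT//.
set e := idem i; pose F (u : 'cV[k]_(rdim M)) := f *m u.
have <- : F @: component i setT = component i [set: 'cV[k]_(rdim N)].
  apply/setP => y; apply/imsetP/imsetP => [[_ /imsetP[w _ ->] ->]|[y' _ ->]].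
    by exists (F w); rewrite ?inE// /F !mulmxA fhom.
  have [w <-] := fsurj y'; exists (M e *m w); first by rewrite imset_f ?inE.
  by rewrite /F !mulmxA fhom.
rewrite -sum1_card (partition_big_imset F) mulnC -sum_nat_const.
apply: eq_bigr => _ /imsetP[u0 u0M ->]; rewrite sum1_card.
rewrite -(card_imset (mem (component i U)) (addrI u0)); apply: eq_card => u.
rewrite unfold_in.
apply/andP/imsetP => [[uM /eqP Fu]|[w wU ->]]; last first.
  have wU' : w \in U by case/imsetP: wU => w' w'U ->; exact: Ug.
  split; last by move: wU'; rewrite UE inE /F mulmxDr => /eqP->; rewrite addr0.
  apply/imsetP; exists (u0 + w); rewrite ?inE//.
  by rewrite mulmxDr (component_id wU) (component_id u0M).
(* A vector of U lying in the component of M at i lies in that of U. *)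
exists (u - u0); last by rewrite addrC subrK.
apply/imsetP; exists (u - u0).
  by rewrite UE inE mulmxBr -/(F u) Fu subrr.
by rewrite mulmxBr (component_id uM) (component_id u0M).
Qed.

Lemma mulmx_cV_ext a b (A B : 'M[k]_(a, b)) :
  (forall x : 'cV_b, A *m x = B *m x) -> A = B.
Proof.
move=> AB; apply/matrixP => i j.
by have /colP/(_ i) := AB (delta_mx j 0); rewrite -!colE !mxE.
Qed.

(** * Submodules and quotients as representations *)

Section Compression.
Variables (M : rep S) (p : nat) (A : 'M[k]_(p, rdim M)) (B : 'M[k]_(rdim M, p)).
Hypothesis AB : A *m B = 1%:M.
(* True in two cases: B is the inclusion of a submodule and A a retraction of it,
   or A is the projection to a quotient and B a section of it. *)
Hypothesis ABM : forall g h, (A *m M g *m B) *m (A *m M h *m B) = A *m (M g *m M h) *m B.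

Lemma compress_subproof : is_rep (fun g => A *m M g *m B).
Proof.
have [Ml Mm Mo M1 Ml' MMl MMr] := ractP M.
split=> [i a x y|i x y|i j x y ij||i j a x y|i j x w|i j w x].
- by rewrite Ml mulmxDr mulmxDl -scalemxAr -scalemxAl.
- by rewrite ABM Mm.
- by rewrite ABM Mo// mulmx0 mul0mx.
- by rewrite -mulmx_suml -mulmx_sumr M1 mulmx1.
- by rewrite Ml' mulmxDr mulmxDl -scalemxAr -scalemxAl.
- by rewrite ABM MMl.
- by rewrite ABM MMr.
Qed.
Definition compress : rep S := Rep compress_subproof.
End Compression.

Lemma submod_mx M (U : {set 'cV[k]_(rdim M)}) : submod U ->
  exists p (W : 'M[k]_(p, rdim M)), forall x, (x \in U) = (x^T <= W)%MS.
Proof.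
move=> /asboolP[U0 UP _].
exists #|U|, (\matrix_i (enum_val i)^T) => x.
apply/idP/submxP => [xU|[D xE]].
  exists (delta_mx 0 (enum_rank_in xU x)).
  by rewrite -rowE rowK enum_rankK_in.
have -> : x = \sum_i D 0 i *: enum_val i.
  apply: trmx_inj; rewrite xE mulmx_sum_row linear_sum; apply: eq_bigr => i _.
  by rewrite rowK linearZ.
elim/big_ind: _ => // [u w uU wU|i _]; first by rewrite -[u]scale1r UP.
by rewrite -[_ *: _]addr0 UP// enum_valP.
Qed.

(** A basis of the row space of W gives the inclusion of U. *)
Lemma submod_iso_sub M (U : {set 'cV[k]_(rdim M)}) : submod U -> exists N, iso_sub U N.
Proof.
move=> subU; have [_ _ Ug] := asboolW subU; have [p [W UE]] := submod_mx subU.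
have /row_freeP[A' BA] := row_base_free W.
pose B := (row_base W)^T; pose A := A'^T.
have AB : A *m B = 1%:M by rewrite -trmx_mul BA trmx1.
have imB x : (x \in U) -> exists y, x = B *m y.
  rewrite UE -(eq_row_base W) => /submxP[D xE]; exists D^T.
  by rewrite -trmx_mul -xE trmxK.
have BU y : B *m y \in U.
  by rewrite UE trmx_mul trmxK (submx_trans (submxMl _ _)) ?eq_row_base.
have BAB g : B *m (A *m M g *m B) = M g *m B.
  apply: mulmx_cV_ext => x; rewrite -!mulmxA.
  have /imB[y ->] := Ug g _ (BU x).
  by rewrite (mulmxA A) AB mul1mx.
have ABM g h : (A *m M g *m B) *m (A *m M h *m B) = A *m (M g *m M h) *m B.
  by rewrite -[LHS]mulmxA BAB !mulmxA.
exists (compress AB ABM); apply/asboolP; exists B; split.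
- by apply/rephomP => g /=; rewrite BAB.
- by move=> x y xy; rewrite -[x]mul1mx -[y]mul1mx -AB -!mulmxA xy.
apply/setP => x; apply/idP/imsetP => [/imB[y ->]|[y _ ->]//]; by exists y; rewrite ?inE.
Qed.

(** The cokernel matrix of W has kernel U, and a basis of its column space gives
    a surjection with the same kernel. *)
Lemma submod_iso_quot M (U : {set 'cV[k]_(rdim M)}) : submod U -> exists N, iso_quot U N.
Proof.
move=> subU; have [_ _ Ug] := asboolW subU; have [p [W UE]] := submod_mx subU.
have /row_fullP[D' DC] := col_base_full (cokermx W).
have /row_freeP[R cR] := row_base_free (cokermx W).
pose C := (col_base (cokermx W))^T; pose D := D'^T.
have CD : C *m D = 1%:M by rewrite -trmx_mul DC trmx1.
have kerC x : (x \in U) = (C *m x == 0).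
  rewrite UE submxE -{1}(mulmx_base (cokermx W)) mulmxA.
  apply/eqP/eqP => [/(congr1 (mulmx^~ R))|Cx].
    rewrite -mulmxA cR mulmx1 mul0mx => /(congr1 trmx).
    by rewrite trmx_mul trmxK trmx0.
  suff -> : x^T *m col_base (cokermx W) = 0 by rewrite mul0mx.
  by apply: trmx_inj; rewrite trmx_mul trmxK Cx trmx0.
have CDC g : (C *m M g *m D) *m C = C *m M g.
  apply: mulmx_cV_ext => x; apply/eqP; rewrite -subr_eq0 -!mulmxA -!mulmxBr.
  by rewrite -kerC; apply: Ug; rewrite kerC mulmxBr !mulmxA CD mul1mx subrr.
have ABM g h : (C *m M g *m D) *m (C *m M h *m D) = C *m (M g *m M h) *m D.
  by rewrite !mulmxA CDC.
exists (compress CD ABM); apply/asboolP; exists C; split.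
- by apply/rephomP => g /=; rewrite CDC.
- by move=> y; exists (D *m y); rewrite mulmxA CD mul1mx.
by apply/setP => x; rewrite inE kerC.
Qed.

(** * Hall numbers as fibre cardinalities *)

Lemma mulmx_inj_cV a b p (f : 'M[k]_(a, b)) :
  injective (fun x : 'cV_b => f *m x) -> injective (fun X : 'M_(b, p) => f *m X).
Proof.
move=> finj X Y fXY; apply: mulmx_cV_ext => x; apply: finj.
by rewrite /= !mulmxA fXY.
Qed.

Lemma mulmx_lift a b c (f : 'M[k]_(a, b)) (h : 'M[k]_(a, c)) :
  (forall x : 'cV_c, exists y, f *m y = h *m x) -> exists g, f *m g = h.
Proof.
move=> fh; have [y yP] := choice (fun j => fh (delta_mx j 0)).
exists (\matrix_(i, j) y j i 0); apply/matrixP => i j.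
have /colP/(_ i) := yP j; rewrite -colE !mxE => <-.
by apply: eq_bigr => l _; rewrite mxE.
Qed.

(** Two embeddings with the same image factor through each other. *)
Lemma iso_sub_uniq M (U : {set 'cV[k]_(rdim M)}) N N' :
  iso_sub U N -> iso_sub U N' -> rep_iso N N'.
Proof.
move=> /asboolP[f [/rephomP fhom finj UE]] /asboolP[f' [/rephomP fhom' finj' UE']].
have lift (x : 'cV_(rdim N)) : exists y, f' *m y = f *m x.
  have : f *m x \in U by rewrite UE imset_f.
  by rewrite UE' => /imsetP[y _ ->]; exists y.
have lift' (x : 'cV_(rdim N')) : exists y, f *m y = f' *m x.
  have : f' *m x \in U by rewrite UE' imset_f.
  by rewrite UE => /imsetP[y _ ->]; exists y.
have [g gE] := mulmx_lift lift; have [g' gE'] := mulmx_lift lift'.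
exists g, g'; split.
- apply/rephomP => x; apply: (mulmx_inj_cV finj').
  by rewrite /= !mulmxA gE fhom' -[RHS]mulmxA gE fhom.
- apply/rephomP => x; apply: (mulmx_inj_cV finj).
  by rewrite /= !mulmxA gE' fhom -[RHS]mulmxA gE' fhom'.
- by apply: (mulmx_inj_cV finj); rewrite /= mulmxA gE' gE mulmx1.
by apply: (mulmx_inj_cV finj'); rewrite /= mulmxA gE gE' mulmx1.
Qed.

Lemma iso_sub_trans M (U : {set 'cV[k]_(rdim M)}) N N' :
  iso_sub U N -> rep_iso N N' -> iso_sub U N'.
Proof.
move=> /asboolP[f [fhom finj ->]] [g [g' [ghom ghom' gg' gg]]].
apply/asboolP; exists (f *m g'); split; first exact: rephom_comp.
  move=> x y /=; rewrite -!mulmxA => /finj xy.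
  by rewrite -[x]mul1mx -[y]mul1mx -gg -!mulmxA xy.
apply/setP => x; apply/imsetP/imsetP => -[y _ ->].
  by exists (g *m y); rewrite // -mulmxA (mulmxA g') gg' mul1mx.
by exists (g' *m y); rewrite // mulmxA.
Qed.

(** Two surjections with the same kernel factor through each other, by means of
    linear sections. *)
Lemma iso_quot_uniq M (U : {set 'cV[k]_(rdim M)}) N N' :
  iso_quot U N -> iso_quot U N' -> rep_iso N N'.
Proof.
move=> /asboolP[f [/rephomP fhom fsurj UE]] /asboolP[f' [/rephomP fhom' fsurj' UE']].
have ker : forall x : 'cV_(rdim M), f *m x = 0 <-> f' *m x = 0.
  move=> x; have : (x \in [set x | f *m x == 0]) = (x \in [set x | f' *m x == 0]).
    by rewrite -UE -UE'.
  by rewrite !inE => e; split=> /eqP; [rewrite e|rewrite -e] => /eqP.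
have [s sE] : exists s, f *m s = 1%:M.
  by apply: mulmx_lift => x; rewrite mul1mx.
have [s' sE'] : exists s, f' *m s = 1%:M.
  by apply: mulmx_lift => x; rewrite mul1mx.
have gE : f' *m s *m f = f'.
  apply: mulmx_cV_ext => x; apply/eqP; rewrite -subr_eq0 -!mulmxA -mulmxBr.
  by apply/eqP/ker; rewrite mulmxBr (mulmxA f s) sE mul1mx subrr.
have gE' : f *m s' *m f' = f.
  apply: mulmx_cV_ext => x; apply/eqP; rewrite -subr_eq0 -!mulmxA -mulmxBr.
  by apply/eqP/ker; rewrite mulmxBr (mulmxA f' s') sE' mul1mx subrr.
exists (f' *m s), (f *m s'); split.
- apply/rephomP => x; rewrite -[LHS]mulmx1 -sE mulmxA -(mulmxA (f' *m s)) -fhom.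
  by rewrite (mulmxA _ f) gE fhom' mulmxA.
- apply/rephomP => x; rewrite -[LHS]mulmx1 -sE' mulmxA -(mulmxA (f *m s')) -fhom'.
  by rewrite (mulmxA _ f') gE' fhom mulmxA.
- by rewrite mulmxA gE' sE.
by rewrite mulmxA gE sE'.
Qed.

Lemma iso_quot_trans M (U : {set 'cV[k]_(rdim M)}) N N' :
  iso_quot U N -> rep_iso N N' -> iso_quot U N'.
Proof.
move=> /asboolP[f [fhom fsurj ->]] [g [g' [ghom ghom' gg' gg]]].
apply/asboolP; exists (g *m f); split; first exact: rephom_comp.
  move=> y; have [x xE] := fsurj (g' *m y); exists x.
  by rewrite -mulmxA xE mulmxA gg mul1mx.
apply/setP => x; rewrite !inE -mulmxA; apply/eqP/eqP => [->|gfx].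
  by rewrite mulmx0.
by rewrite -[LHS]mul1mx -gg' -mulmxA gfx mulmx0.
Qed.

Definition isorep_class N : isorep S :=
  \pi_(isorep S)%qT (N : {classic rep S}).

Lemma isorep_classP N c : isorep_class N = c <-> rep_iso N (isorep_repr c).
Proof.
rewrite -{1}[c]reprK; split=> [/eqmodP/asboolP //|Nc].
by apply/eqmodP/asboolP.
Qed.

(** Sending a submodule U to the classes of L / U and U turns the Hall numbers
    into the cardinalities of fibres. *)
Lemma hall_number_fibre L : exists phi : {set 'cV[k]_(rdim L)} -> isorep S * isorep S,
  (forall c, hall_number (isorep_repr c.1) (isorep_repr c.2) L =
    #|[set U | submod U & phi U == c]|) /\
  forall U, submod U -> dimvec (isorep_repr (phi U).2) = dimvec_sub U /\
    dimvec (isorep_repr (phi U).1) = dimvec L - dimvec_sub U.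
Proof.
have /choice[phi phiP] : forall U : {set 'cV[k]_(rdim L)}, exists c0, submod U ->
    forall c : isorep S * isorep S,
      (iso_sub U (isorep_repr c.2) && iso_quot U (isorep_repr c.1)) = (c0 == c).
  move=> U; case: (pselect (submod U)) => [subU|nU]; last first.
    by exists (isorep_class (zero_rep S), isorep_class (zero_rep S)) => /nU.
  have [N UN] := submod_iso_sub subU; have [N' UN'] := submod_iso_quot subU.
  exists (isorep_class N', isorep_class N) => _ [c1 c2] /=.
  apply/andP/eqP => [[c2U c1U]|[/isorep_classP c1N /isorep_classP c2N]].
    congr (_, _); apply/isorep_classP; first exact: iso_quot_uniq UN' c1U.
    exact: iso_sub_uniq UN c2U.
  by split; [exact: iso_sub_trans UN c2N|exact: iso_quot_trans UN' c1N].
exists phi; split=> [c|U subU].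
  apply: eq_card => U; rewrite !inE.
  by case: (boolP (submod U)) => // /phiP ->.
have := phiP U subU (phi U); rewrite eqxx => /andP[subN quotN].
rewrite (dimvec_iso_sub subU subN) (dimvec_iso_quot subU quotN).
by split=> //; rewrite addrC addKr.
Qed.

Lemma dimvec_zero : dimvec (zero_rep S) = 0.
Proof.
apply/colP => i; rewrite [RHS]mxE /dimvec -absz_dimvec_sub; apply: (congr1 Posz).
apply: (@expn_card_inj i); rewrite -card_component ?submodT//.
rewrite (_ : component i _ = [set 0]) ?cards1//.
apply/setP => u; rewrite inE; apply/imsetP/eqP => [_|->].
  by apply/colP => -[].
by exists 0; rewrite ?inE// mulmx0.
Qed.
End Submodules.

(** * Sums weighted by fibre cardinalities *)

Section FibreSum.
Variables (R : nzRingType) (V : lmodType R) (I : choiceType) (T : finType).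

(** The sum on the left has finite support, since only the values of phi
    contribute; this is what makes it the finite sum on the right instead of
    the default value of an infinite sum. *)
Lemma fsum_card_fibre (p : pred T) (phi : T -> I) (F : I -> V) :
  \sum_(i \in [set: I]%classic) #|[set t | p t & phi t == i]|%:R *: F i =
  \sum_(t | p t) F (phi t).
Proof.
pose A := [fset phi t | t in T]%fset.
have phiA t : phi t \in A by apply/imfsetP; exists t.
rewrite (@fsbigTE _ _ _ _ A) => [|i iA]; last first.
  rewrite (_ : [set t | _] = set0) ?cards0 ?scale0r//.
  by apply/setP => t; rewrite !inE; apply: contraNF iA => /andP[_ /eqP <-].
transitivity (\sum_(i <- A) \sum_(t | p t && (phi t == i)) F i).
  apply: eq_bigr => i _; rewrite sumr_const scaler_nat.
  by congr (_ *+ _); apply: eq_card => t; rewrite inE.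
rewrite (exchange_big_dep p) /= => [|i t _ /andP[]//]; apply: eq_bigr => t pt.
rewrite (eq_bigl (fun i => i == phi t)) => [|i]; last by rewrite pt eq_sym.
by rewrite (fbig_pred1_inj (k := id)).
Qed.
End FibreSum.

Lemma linear_comb (R : nzRingType) (V W : lmodType R) (f : V -> W) (I : finType)
    (p : pred I) (c : I -> R) (x : I -> V) : linear f ->
  f (\sum_(i | p i) c i *: x i) = \sum_(i | p i) c i *: f (x i).
Proof.
move=> flin; pose g : {linear V -> W} :=
  HB.pack f (GRing.isLinear.Build R V W _ f flin).
rewrite -[f]/(g : V -> W) linear_sum; apply: eq_bigr => i _; exact: linearZ.
Qed.

(** * Evaluation of the map Psi *)

Lemma eulervNl (k : finFieldType) (m : nat) (Q : vquiver m) (S : species k Q)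
    (a b : 'cV[int]_m) : eulerv S (- a) b = - eulerv S a b.
Proof.
rewrite /eulerv -sumrN; apply: eq_bigr => i _; rewrite -sumrN.
by apply: eq_bigr => j _; rewrite mxE !mulNr.
Qed.

(** The power of q in Delta and the power of v in mu combine, as q = v^2. *)
Lemma q_v_exp (k : finFieldType) (x y : int) :
  (#|k|%:R : laurent k) ^ x * vq k ^ (- (x + y) - x) = vq k ^ (- y).
Proof.
rewrite -vqq exprnP exprz_exp -exprzDr ?vq_unit//; congr (_ ^ _).
by ring.
Qed.

Lemma mu_tens (k : finFieldType) (n : nat) (Qt : vquiver (n + n))
    (St : species k Qt) (Lam : 'M[int]_(n + n)) (a b : 'cV[int]_n) :
  let S := species_init St in
  mu_T St Lam (tens << col_mx a 0 >> << col_mx b 0 >>) =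
  vq k ^ (- (eulerv S a b + eulerv S b a) - eulerv S a b) *:
    qtorus_X Lam (- (Et St *m a) - Et' St *m b).
Proof.
rewrite /mu_T (tensor_lift_tens _ _ (bilin_extPl _) (bilin_extPr _)) bilin_extU.
by rewrite /mu_basis !col_mxKu !col_mxKd !col_mx0 !addr0.
Qed.

Theorem lemma6p7 (k : finFieldType) (n : nat) (Qt : vquiver (n + n))
    (St : species k Qt) (Lam : 'M[int]_(n + n))
    (MH : algType (laurent k))
    (iota : {linear hall_alg (species_init St) -> MH})
    (K : 'cV[int]_n -> MH)
    (Delta : {linear MH -> tensor MH MH})
    (intg : {linear MH -> {malg (laurent k)['cV[int]_(n + n)]}})
    (Q_acyclic : acyclic (vquiver_init Qt))
    (Lam_compatible : compatible St Lam)
    (iota_loc : is_localization iota)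
    (K_def : is_K iota K)
    (Delta_def : is_Delta iota K Delta)
    (intg_def : is_int iota K intg)
    (M : rep (species_init St)) (P : projrep (species_init St))
    (hP : Et' St *m dimvec P = col_mx (top_dimvec P) 0) :
  Psi St Lam Delta intg (XMP iota K M P) = cluster_char Lam M P.
Proof.
set S := species_init St in iota iota_loc K_def Delta_def intg_def M P hP *.
(* The defining relation of K at the zero module, whose class is invertible. *)
have K0 : K 0 = 1.
  have [y [_ y1]] := loc_inv iota_loc (proj0 S).
  have := K_def (proj0 S) (proj0 S); rewrite subrr => /(congr1 ( *%R^~ y)).
  by rewrite -mulrA y1 mulr1.
(* Taking P = 0 in the defining relation of the integration map gives its value
   on X_N. *)
have XP0 : XP iota (proj0 S) = 1 := loc_1 iota_loc.
have intXM N : intg (XM iota K N) = << col_mx (dimvec N) 0 >>.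
  have -> : XM iota K N = K 0 * XMP iota K N (proj0 S).
    by rewrite /XMP XP0 mulr1 K0 mul1r.
  by rewrite intg_def dimvec_zero !col_mx0 subr0 add0r.
have [phi [hallE phiE]] := hall_number_fibre M.
pose F (c : isorep S * isorep S) : tensor MH MH :=
  (#|k|%:R ^ eulerv S (dimvec (isorep_repr c.1)) (dimvec (isorep_repr c.2) - dimvec P)) *:
    tens (XM iota K (isorep_repr c.1)) (K 0 * XMP iota K (isorep_repr c.2) P).
have DeltaE : Delta (XMP iota K M P) = \sum_(U | submod U) F (phi U).
  rewrite -[XMP _ _ _ _]mul1r -K0 Delta_def -fsum_card_fibre.
  by apply: eq_fsbigr => c _; rewrite -hallE scalerA mulrC.
rewrite /Psi DeltaE /F /cluster_char.
have intl a x y y' : tens (intg (a *: x + y)) (intg y') =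
   a *: tens (intg x) (intg y') + tens (intg y) (intg y').
  by rewrite linearP tensPl.
have intr a x y y' : tens (intg x) (intg (a *: y + y')) =
   a *: tens (intg x) (intg y) + tens (intg x) (intg y').
  by rewrite linearP tensPr.
have mapl : linear (tensor_map intg intg) := tensor_lift_linear intl intr.
have mul : linear (@mu_T k n Qt St Lam).
  exact: (tensor_lift_linear (bilin_extPl _) (bilin_extPr _)).
rewrite (linear_comb _ _ _ mapl) (linear_comb _ _ _ mul).
pose G (e : 'cV[int]_n) : qtorus k Lam := vq k ^ eulerv S (dimvec P - e) (dimvec M - e) *:
  qtorus_X Lam (- (Bt St *m e) - Et St *m dimvec M + col_mx (top_dimvec P) 0).
transitivity (\sum_(U : {set 'cV[k]_(rdim M)} | submod U) G (dimvec_sub U)); last first.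
  rewrite -fsum_card_fibre; apply: eq_fsbigr => e _.
  by rewrite /G scalerA mulrC.
apply: eq_bigr => U /phiE.
move: (isorep_repr (phi U).2) (isorep_repr (phi U).1) => N N' [eN eN'].
have -> : tensor_map intg intg (tens (XM iota K N') (K 0 * XMP iota K N P)) =
    tens (intg (XM iota K N')) (intg (K 0 * XMP iota K N P)).
  exact: (@tensor_lift_tens _ _ _ _ (fun x y => tens (intg x) (intg y))
    (XM iota K N') (K 0 * XMP iota K N P) intl intr).
rewrite intXM intg_def !col_mx0 add0r opp_col_mx add_col_mx subr0.
rewrite mu_tens scalerA q_v_exp -eulervNl opprB eN eN' /G; congr (_ *: qtorus_X _ _).
have -> : Bt St = Et' St - Et St by rewrite /Et /Et' opprB addrC addrA subrK.
(* Otherwise rewriting with [mulmxBr] would unfold E and E', which are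
   differences themselves. *)
rewrite -hP; move: (Et St) (Et' St) => A A'.
rewrite !mulmxBr mulmxBl !opprB -!addrA [X in _ = _ + X]addrCA.
by rewrite [- (A' *m dimvec_sub U) + _]addrC.
Qed.
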